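(* Fix a real number $k>1$. (i) Choose a real number $a_1>0$ and set $a_2=(k-1)a_1$. For each $n\ge 2$, choose real numbers $b_n,c_n>0$ with $b_n+c_n=k$, and define $$a_{2n-1}=b_n\,a_n,\qquad a_{2n}=c_n\,a_n\qquad (n\ge 2).$$ Then the sequence $(a_n)_{n\ge 1}$ satisfies $S_{2n}=k\,S_n$ for every $n\ge 1$, where $S_n=\sum_{i=1}^n a_i$. (ii) Conversely, every sequence $(a_n)_{n\ge 1}$ of positive real numbers satisfying $S_{2n}=k\,S_n$ for every $n\ge 1$ arises uniquely in the way described in (i), with $$a_2=(k-1)a_1,\qquad b_n=\frac{a_{2n-1}}{a_n},\qquad c_n=\frac{a_{2n}}{a_n}\qquad (n\ge 2).$$
   Context: For a sequence $(a_n)_{n\ge1}$, $S_n=\sum_{i=1}^n a_i$ denotes its partial sums, and the relation $S_{2n}=k\,S_n$ for all $n\ge 1$ is called the Galileo relation with constant $k$. ''Arises uniquely'' in (ii) means that there is exactly one choice of $a_1>0$ and of positive real pairs $(b_n,c_n)_{n\ge 2}$ with $b_n+c_n=k$ for which the construction in (i) produces the given sequence. *)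

(* Defs.v *)
From mathcomp Require Import all_boot all_order all_algebra.
From mathcomp Require Import reals.

Set Implicit Arguments.
Unset Strict Implicit.
Unset Printing Implicit Defensive.

Import Order.TTheory GRing.Theory Num.Theory.
Local Open Scope ring_scope.

(* A sequence (a_n)_{n >= 1} is a function [nat -> R] whose value at 0 is
   never used; likewise (b_n)_{n >= 2} and (c_n)_{n >= 2} are functions
   [nat -> R] whose values at 0 and 1 are never used. *)

Definition partial_sum (R : realType) (a : nat -> R) (n : nat) : R :=
  \sum_(1 <= i < n.+1) a i.

Definition galileo (R : realType) (k : R) (a : nat -> R) : Prop :=
  forall n : nat, (1 <= n)%N ->
    partial_sum a (2 * n)%N = k * partial_sum a n.

Definition admissible_choice (R : realType) (k a1 : R) (b c : nat -> R) : Prop :=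
  0 < a1 /\
  forall n : nat, (2 <= n)%N -> [/\ 0 < b n, 0 < c n & b n + c n = k].

(* These equations determine a_n for every n >= 1, since 2n - 1 > n when
   n >= 2. *)
Definition produces (R : realType) (k a1 : R) (b c a : nat -> R) : Prop :=
  [/\ a 1%N = a1,
      a 2%N = (k - 1) * a1
    & forall n : nat, (2 <= n)%N ->
        a (2 * n - 1)%N = b n * a n /\ a (2 * n)%N = c n * a n].

(* Main.v *)
(** Telescoping the Galileo relation turns it into [a_2 = (k - 1) a_1] together
    with [a_(2n-1) + a_(2n) = k a_n] for [n >= 2]; the pairs [(b_n, c_n)] are the
    ratios in which this sum is split, and they are determined since [a_n > 0]. *)

Require Import Defs.
From mathcomp Require Import all_boot all_order all_algebra.
From mathcomp Require Import reals.
From mathcomp Require Import zify ring lra.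
Import Order.TTheory GRing.Theory Num.Theory.
Local Open Scope ring_scope.

Lemma partial_sumS (R : realType) (a : nat -> R) (n : nat) :
  partial_sum a n.+1 = partial_sum a n + a n.+1.
Proof. by rewrite /partial_sum big_nat_recr. Qed.

Lemma partial_sum1 (R : realType) (a : nat -> R) : partial_sum a 1 = a 1%N.
Proof. by rewrite /partial_sum big_nat1. Qed.

Lemma partial_sum_double (R : realType) (a : nat -> R) (n : nat) :
  partial_sum a (2 * n.+1) =
  partial_sum a (2 * n) + (a (2 * n.+1 - 1)%N + a (2 * n.+1)%N).
Proof.
rewrite (_ : (2 * n.+1 = (2 * n).+2)%N); last by lia.
by rewrite !partial_sumS subn1 addrA.
Qed.

(** Subtracting the relation at [n - 1] from the one at [n] isolates the pair of terms added on the
    left; induction from [n = 1] sums these pairs back. *)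
Lemma galileoP (R : realType) (k : R) (a : nat -> R) :
  galileo k a <->
  a 2%N = (k - 1) * a 1%N /\
  forall n : nat, (2 <= n)%N -> a (2 * n - 1)%N + a (2 * n)%N = k * a n.
Proof.
split=> [gal | [a2 step]].
  split=> [|[//|n] n_ge2].
    by have := gal 1%N isT; rewrite muln1 partial_sumS partial_sum1 => ?; lra.
  (* The index here is [n.+1], at least 2, so the relation also holds at [n], and the common summand
     [k * partial_sum a n] cancels. *)
  have := gal n.+1 isT; rewrite partial_sum_double gal // partial_sumS.
  by rewrite mulrDr => /addrI.
elim=> [//|[_ _|n IHn _]].
  by rewrite muln1 partial_sumS partial_sum1 a2; ring.
by rewrite partial_sum_double IHn // step // (partial_sumS _ _ n.+1) mulrDr.
Qed.

(** Both [2n - 1] and [2n] have upper half [n], and parity selects [b] or [c]; so each index above 2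
    is governed by exactly one equation. The descent to [uphalf n] is not structural, hence the
    fuel. *)
Fixpoint galileo_rec {R : realType} (k a1 : R) (b c : nat -> R)
    (fuel n : nat) : R :=
  if fuel is m.+1 then
    if (n <= 1)%N then a1 else
    if n == 2 then (k - 1) * a1 else
    (if odd n then b else c) (uphalf n) * galileo_rec k a1 b c m (uphalf n)
  else a1.

(** Since [uphalf n < n] for [n >= 2], the index drops at least as fast as the fuel, so fuel [n]
    never runs out too early. *)
Lemma galileo_rec_fuel (R : realType) (k a1 : R) (b c : nat -> R)
    (m1 m2 n : nat) : (n <= m1)%N -> (n <= m2)%N ->
  galileo_rec k a1 b c m1 n = galileo_rec k a1 b c m2 n.
Proof.
elim: m1 m2 n => [|m1 IH] [|m2] n //= le1 le2; try by rewrite (_ : (n <= 1)%N) //; lia.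
case: leqP => // n_gt1; case: eqP => // n_neq2.
by congr (_ * _); apply: IH; rewrite uphalf_half; lia.
Qed.

Lemma galileo_recE (R : realType) (k a1 : R) (b c : nat -> R) (n : nat) :
  (2 < n)%N ->
  galileo_rec k a1 b c n n =
  (if odd n then b else c) (uphalf n) *
  galileo_rec k a1 b c (uphalf n) (uphalf n).
Proof.
case: n => [//|n] n_gt2.
(* One unfolding of the left side leaves fuel [n], so the fuel on the right is first raised from
   [uphalf n.+1] to [n]. *)
rewrite (galileo_rec_fuel _ _ _ _ _ (uphalf n.+1) n) //; last by lia.
by rewrite [LHS]/= leqNgt (ltnW n_gt2) /= gtn_eqF.
Qed.

Lemma produces_galileo_rec (R : realType) (k a1 : R) (b c : nat -> R) :
  produces k a1 b c (fun n => galileo_rec k a1 b c n n).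
Proof.
split=> // n n_ge2; split; rewrite galileo_recE; try lia.
  have -> : odd (2 * n - 1) by lia.
  by have -> : uphalf (2 * n - 1) = n by lia.
have -> : odd (2 * n) = false by lia.
by have -> : uphalf (2 * n) = n by lia.
Qed.

Theorem theorem5 (R : realType) (k : R) (hk : 1 < k) :
  (forall (a1 : R) (b c : nat -> R), admissible_choice k a1 b c ->
     (exists a : nat -> R, produces k a1 b c a) /\
     (forall a : nat -> R, produces k a1 b c a -> galileo k a))
  /\
  (forall a : nat -> R,
     (forall n : nat, (1 <= n)%N -> 0 < a n) -> galileo k a ->
     [/\ admissible_choice k (a 1%N)
           (fun n => a (2 * n - 1)%N / a n) (fun n => a (2 * n)%N / a n),
         produces k (a 1%N)
           (fun n => a (2 * n - 1)%N / a n) (fun n => a (2 * n)%N / a n) a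
       & forall (a1 : R) (b c : nat -> R),
           admissible_choice k a1 b c -> produces k a1 b c a ->
           a1 = a 1%N /\
           forall n : nat, (2 <= n)%N ->
             b n = a (2 * n - 1)%N / a n /\ c n = a (2 * n)%N / a n]).
Proof.
split=> [a1 b c [_ bc] | a a_gt0 /galileoP[a2 step]].
  split; first by exists (fun n => galileo_rec k a1 b c n n);
    exact: produces_galileo_rec.
  move=> a [a1E a2E rec]; apply/galileoP; split=> [|n n_ge2].
    by rewrite a1E.
  (* The pair of terms is [b n * a n + c n * a n], and [b n + c n = k]. *)
  have [-> ->] := rec n n_ge2; have [_ _ <-] := bc n n_ge2.
  by rewrite mulrDl.
have a_neq0 n : (2 <= n)%N -> a n != 0.
  by move=> n_ge2; rewrite gt_eqF // a_gt0 // ltnW.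
split.
- split=> [|n n_ge2]; first exact: a_gt0.
  split; try by rewrite divr_gt0 // a_gt0 //; lia.
  by rewrite -mulrDl step // mulfK // a_neq0.
- by split=> // n n_ge2; rewrite !divfK // a_neq0.
- move=> a1 b c _ [-> _ rec]; split=> // n n_ge2.
  (* Any admissible [b n] and [c n] are recovered by dividing their defining equations by [a n],
     which is nonzero. *)
  by have [-> ->] := rec n n_ge2; rewrite !mulfK // a_neq0.
Qed.
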